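(* Let $N\ge2$, $0<s<1$ and let $f:\mathbb{R}\to\mathbb{R}$ be a Lipschitz continuous function. Assume that $u\in C^{2}(B_{1})\cap\mathcal{L}_{s}$ is a (classical, pointwise) solution of $$\begin{cases}-\mathcal{I}u=f(u)&\text{in }B_{1},\\ u>0&\text{in }B_{1},\\ u=0&\text{in }\mathbb{R}^{N}\setminus B_{1}.\end{cases}$$ Then for every $i\in\{1,\dots,N\}$, $u$ is symmetric with respect to the hyperplane $P_{e_{i},0}=\{x\in\mathbb{R}^N:x_i=0\}$ and $u$ decreases in the $e_{i}$ direction.
   Context: $B_1$ is the open unit ball of $\mathbb{R}^N$ centered at the origin, and $e_1,\dots,e_N$ is the standard orthonormal basis of $\mathbb{R}^N$. The operator is $\mathcal{I}u=\sum_{i=1}^{N}\mathcal{I}_iu$, where $$\mathcal{I}_{i}u(x)=\frac{C_{s}}{2}\int_{\mathbb{R}}\frac{u(x+te_{i})+u(x-te_{i})-2u(x)}{|t|^{1+2s}}\,dt,\qquad C_{s}=\left(\int_{\mathbb{R}}\frac{1-\cos x}{|x|^{1+2s}}\,dx\right)^{-1}.$$ The space $\mathcal{L}_s$ is $$\mathcal{L}_{s}=\left\{u\in L^{1}_{loc}(\mathbb{R}^{N}):\limsup_{|x|\to+\infty}\frac{|u(x)|}{|x|^{2s-\delta_{1}}}<+\infty\text{ for some }\delta_{1}\in(0,2s]\right\}.$$ ''$u$ is symmetric with respect to $P_{e_i,0}$'' means $u$ is invariant under $x_i\mapsto-x_i$. ''$u$ decreases in the $e_i$ direction'' means decreasing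 away from the symmetry hyperplane inside $B_1$: for every $z\in P_{e_i,0}$ and all $0\le t_1<t_2$ with $z+t_1e_i,\,z+t_2e_i\in B_1$, $u(z+t_2e_i)<u(z+t_1e_i)$.
   Formalization: The solution u is additionally assumed continuous on the closed unit ball; without this the claim fails, e.g. for u=(1-|x|^2)_+^{s-1} with f=0, which solves the problem but increases away from the hyperplanes. *)

(* Defs.v *)
From HB Require Import structures.
From mathcomp Require Import all_boot all_order all_algebra.
From mathcomp Require Import all_classical all_reals all_analysis.
Import Order.TTheory GRing.Theory Num.Theory.
Import numFieldNormedType.Exports.

Set Implicit Arguments.
Unset Strict Implicit.
Unset Printing Implicit Defensive.

Local Open Scope classical_set_scope.
Local Open Scope ring_scope.

(* R^N is 'rV[R]_N. The library norm on 'rV[R]_N is the sup norm, whence the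
   separate Euclidean norm; both induce the same topology. *)
Definition enorm (R : realType) (N : nat) (x : 'rV[R]_N) : R :=
  Num.sqrt (\sum_(i < N) x 0 i ^+ 2).

Definition unit_ball (R : realType) (N : nat) : set 'rV[R]_N :=
  [set x | enorm x < 1].

Definition basis_vec (R : realType) (N : nat) (i : 'I_N) : 'rV[R]_N :=
  delta_mx 0 i.

Definition C1_on (R : realType) (N : nat) (A : set 'rV[R]_N)
    (u : 'rV[R]_N -> R) : Prop :=
  forall i : 'I_N, (forall x, A x -> derivable u x (basis_vec R i)) /\
    (forall x, A x -> {for x, continuous (fun y => 'D_(basis_vec R i) u y)}).

(* To be used with A open, so that the values of the iterated derivatives and
   the continuity at points of A only involve the values of u in A. *)
Definition C2_on (R : realType) (N : nat) (A : set 'rV[R]_N)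
    (u : 'rV[R]_N -> R) : Prop :=
  C1_on A u /\
  forall i : 'I_N, C1_on A (fun x => 'D_(basis_vec R i) u x).

Definition cons_coord (R : realType) (n : nat)
    (p : n.-tuple (measurableTypeR R) * measurableTypeR R) :
    n.+1.-tuple (measurableTypeR R) :=
  [tuple of p.2 :: p.1].

Lemma measurable_cons_coord (R : realType) (n : nat) :
  measurable_fun setT (@cons_coord R n).
Proof. exact: measurable_cons. Qed.

Definition cons_measure (R : realType) (n : nat)
    (m : {measure set (n.-tuple (measurableTypeR R)) -> \bar R}) :
    set (n.+1.-tuple (measurableTypeR R)) -> \bar R :=
  pushforward (m \x @lebesgue_measure R)%E (@cons_coord R n).

HB.instance Definition _ (R : realType) (n : nat)
    (m : {measure set (n.-tuple (measurableTypeR R)) -> \bar R}) :=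
  Measure.copy (cons_measure m)
    (measure_function_pushforward__canonical__measure_function_Measure
      (m \x @lebesgue_measure R)%E (@measurable_cons_coord R n)).

(* N-dimensional Lebesgue measure on the Borel sets of R^N, with R^N seen as
   N.-tuple R, which carries the product sigma-algebra in the library. *)
Fixpoint lebesgue_tuple (R : realType) (n : nat) :
    {measure set (n.-tuple (measurableTypeR R)) -> \bar R} :=
  match n with
  | 0 => \d_ [tuple]
  | m.+1 => cons_measure (lebesgue_tuple R m)
  end.

Definition row_of_tuple (R : realType) (N : nat) (t : N.-tuple R) : 'rV[R]_N :=
  \row_(i < N) tnth t i.

Definition L1loc (R : realType) (N : nat) (u : 'rV[R]_N -> R) : Prop :=
  measurable_fun [set: N.-tuple (measurableTypeR R)] (u \o @row_of_tuple R N) /\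
  forall K : set 'rV[R]_N, compact K ->
    (\int[lebesgue_tuple R N]_(t in @row_of_tuple R N @^-1` K)
       `|u (row_of_tuple t)|%:E < +oo)%E.

Definition at_infinity (R : realType) (N : nat) : set_system 'rV[R]_N :=
  [set V | exists M : R, forall x, M < enorm x -> V x].

Definition Ls_space (R : realType) (N : nat) (s : R) : set ('rV[R]_N -> R) :=
  [set u | L1loc u /\
    exists delta1 : R, 0 < delta1 <= 2 * s /\
      (limf_esup (fun x : 'rV[R]_N =>
         (`|u x| / (enorm x `^ (2 * s - delta1)))%:E) (@at_infinity R N) < +oo)%E].

Definition Cs (R : realType) (s : R) : R :=
  (\int[@lebesgue_measure R]_x ((1 - cos x) / (`|x| `^ (1 + 2 * s))))^-1.

Definition I_dir (R : realType) (N : nat) (s : R) (i : 'I_N)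
    (u : 'rV[R]_N -> R) (x : 'rV[R]_N) : R :=
  Cs s / 2 *
  \int[@lebesgue_measure R]_t
    ((u (x + t *: basis_vec R i) + u (x - t *: basis_vec R i) - 2 * u x)
       / (`|t| `^ (1 + 2 * s))).

Definition I_op (R : realType) (N : nat) (s : R)
    (u : 'rV[R]_N -> R) (x : 'rV[R]_N) : R :=
  \sum_(i < N) I_dir s i u x.

(* Continuity up to the boundary is part of the notion of classical solution
   of the Dirichlet problem. It cannot be dropped: x |-> (1 - |x|^2)_+^(s - 1)
   is smooth in B_1, belongs to L_s, and solves the problem pointwise with
   f = 0 (its restriction to each line parallel to an axis is s-harmonic in
   B_1), but it increases away from the coordinate hyperplanes. Together with
   u = 0 outside B_1 and u in C^2(B_1), it makes the integrals in [I_dir]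
   absolutely convergent at every point of B_1. *)
Definition classical_solution (R : realType) (N : nat) (s : R) (f : R -> R)
    (u : 'rV[R]_N -> R) : Prop :=
  [/\ {within closure (@unit_ball R N), continuous u},
      forall x, unit_ball x -> - I_op s u x = f (u x),
      forall x, unit_ball x -> 0 < u x &
      forall x, ~ unit_ball x -> u x = 0].

Definition hyperplane (R : realType) (N : nat) (i : 'I_N) : set 'rV[R]_N :=
  [set x | x 0 i = 0].

Definition reflection (R : realType) (N : nat) (i : 'I_N) (x : 'rV[R]_N) :
    'rV[R]_N :=
  \row_(j < N) (if j == i then - x 0 j else x 0 j).

Definition symmetric_wrt (R : realType) (N : nat) (i : 'I_N)
    (u : 'rV[R]_N -> R) : Prop :=
  forall x, u (reflection i x) = u x.

Definition decreasing_in (R : realType) (N : nat) (i : 'I_N)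
    (u : 'rV[R]_N -> R) : Prop :=
  forall (z : 'rV[R]_N) (t1 t2 : R), hyperplane i z -> 0 <= t1 -> t1 < t2 ->
    unit_ball (z + t1 *: basis_vec R i) ->
    unit_ball (z + t2 *: basis_vec R i) ->
    u (z + t2 *: basis_vec R i) < u (z + t1 *: basis_vec R i).

(* Main.v *)
Require Import Defs.
From HB Require Import structures.
From mathcomp Require Import all_boot all_order all_algebra.
From mathcomp Require Import all_classical all_reals all_analysis.
From mathcomp Require Import measurable_realfun.
From mathcomp Require Import ring lra.
Import Order.TTheory GRing.Theory Num.Theory.
Import numFieldNormedType.Exports.

Local Open Scope classical_set_scope.
Local Open Scope ring_scope.

(** The proof is the method of moving planes. Fix a coordinate direction e_i,
    let x^lam be the mirror image of x in the hyperplane {x_i = lam}, and put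
    w_lam(x) = u(x^lam) - u(x), the [deficit]. The claim is that w_lam >= 0 on
    {x_i >= lam} for every lam in (0,1). Then w_lam > 0 at the points of the
    ball with x_i > lam, which is the strict monotonicity along e_i
    ([regular_solution_decreasing]), and letting lam tend to 0 for both u and
    its mirror image gives the symmetry ([regular_solution_symmetric]).

    Everything rests on evaluating the operator at a point x of the ball where
    w_lam attains its minimum -m <= 0 over the half space {x_i >= lam}. On one side
    the equation and the Lipschitz constant L of f give I w_lam(x) <= L m. On the
    other side a line in a direction e_j with j <> i through x stays in the
    half space, so I_j w_lam(x) >= 0. In the direction e_i the restriction of
    w_lam to the line is odd about the hyperplane, at distance d from x:
    reflecting the half line beyond the hyperplane onto the other one turns the
    kernel K into the difference K(t) - K(t + 2d) >= 0, plus a gain of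
    2m K(t + 2d) ([antisymmetric_integral_ge]), whence
    I w_lam(x) >= c m d^(-2s). Two consequences follow.
    - If m > 0, then d is at least a constant d0 depending only on s and L
      ([narrow_region]): negative values of w_lam cannot be confined to a
      narrow strip along the hyperplane. In particular there are none when lam
      is close to 1.
    - If m = 0, then w_lam cannot be positive anywhere on the line beyond x
      ([zero_minimum_not_positive]). But it is positive where the line leaves
      the ball, since u vanishes there and is positive at the mirror image.
      So w_lam > 0 up to the spherical part of the boundary ([deficit_gt0]).

    If the claim failed for some lam, let l be the supremum of the bad values.
    By continuity w_l >= 0, hence w_l > 0 on the compact cap
    {|x| <= 1, x_i >= l + d0/2}; this persists for the planes near l, while a bad
    value just below l has a point of negative deficit at distance at least d0
    from its hyperplane, that is, in the cap ([deficit_ge0]).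

    All of this needs I_j u to be an absolutely convergent integral at the
    points of the ball, and the normalizing constant to be positive: both come
    from the fact that the second difference of a bounded function which is C^2
    at the base point is integrable against the kernel
    ([integrable_second_difference]). *)

Set Implicit Arguments.
Unset Strict Implicit.
Unset Printing Implicit Defensive.

(** * Reflections of the line and lower bounds for integrals *)

Section line_integrals.
Context {R : realType}.
Local Notation mu := (@lebesgue_measure R).
Implicit Types (f g : R -> R) (a b c k p x s r t M : R).

(** The reflection of the line about [c / 2]. *)
Definition flip c (t : R) : R := c - t.

Lemma flipK c : involutive (flip c).
Proof. by move=> t; rewrite /flip opprB addrC subrK. Qed.

Lemma continuous_flip c : continuous (flip c).
Proof. by move=> t; apply: cvgB; [exact: cvg_cst|exact: cvg_id]. Qed.

Lemma measurable_flip c : measurable_fun [set: R] (flip c).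
Proof. by apply: continuous_measurable_fun; exact: continuous_flip. Qed.

Lemma flip_preimage_itvoc c a b :
  flip c @^-1` `]a, b] = `[c - b, c - a[%classic.
Proof.
apply/seteqP; split => t /=; rewrite !in_itv /flip /= => /andP[h1 h2];
  apply/andP; split; lra.
Qed.

(** A reflection maps intervals to intervals of the same length, up to
    endpoints, and Lebesgue measure is determined by its values on intervals. *)
Lemma lebesgue_measure_flip c (A : set R) : measurable A ->
  mu A = pushforward mu (flip c) A.
Proof.
move=> mA.
pose m := @measure_function_pushforward__canonical__measure_function_Measure
  _ _ (measurableTypeR R) (measurableTypeR R) R mu (flip c) (measurable_flip c).
apply: (@lebesgue_measure_unique R m _ A mA) => _ [[a b] _ <-] /=.
rewrite /pushforward flip_preimage_itvoc !lebesgue_measure_itv /= !lte_fin.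
have -> : (c - b < c - a) = (a < b) by rewrite ltrD2l ltrN2.
by case: ifP => // _; rewrite -!EFinB; congr EFin; lra.
Qed.

Lemma ge0_integral_flip c (f : R -> \bar R) : measurable_fun [set: R] f ->
  (forall t, 0 <= f t)%E ->
  (\int[mu]_t f (flip c t) = \int[mu]_t f t)%E.
Proof.
move=> mf f0.
have E := @ge0_integral_pushforward _ _ (measurableTypeR R) (measurableTypeR R) R
  (flip c) (measurable_flip c) mu setT f
  measurableT mf (fun y _ => f0 y).
rewrite preimage_setT in E; rewrite -{}E.
apply: (@eq_measure_integral _ _ _ _ mu
  (@measure_function_pushforward__canonical__measure_function_Measure
     _ _ (measurableTypeR R) (measurableTypeR R) R mu (flip c)
     (measurable_flip c))) => A mA _.
exact/esym/lebesgue_measure_flip.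
Qed.

Lemma integrable_flip c f : mu.-integrable setT (EFin \o f) ->
  mu.-integrable setT (EFin \o (f \o flip c)).
Proof.
move=> /integrableP[mf fin]; apply/integrableP; split.
  exact: (measurableT_comp mf (measurable_flip c)).
rewrite (@ge0_integral_flip c (fun t => `|(f t)%:E|%E))//.
exact: measurableT_comp.
Qed.

Lemma Rintegral_flip c f : mu.-integrable setT (EFin \o f) ->
  \int[mu]_t f (flip c t) = \int[mu]_t f t.
Proof.
move=> intf; congr fine; rewrite integralE [RHS]integralE.
have mf : measurable_fun setT (EFin \o f) by case/integrableP: intf.
congr (_ - _)%E.
- rewrite -(ge0_integral_flip c (measurable_funepos mf) (funepos_ge0 _)).
  by apply: eq_integral => t _; rewrite -[RHS]/(((EFin \o f)^\+ \o flip c)%E t)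
    -funepos_comp.
- rewrite -(ge0_integral_flip c (measurable_funeneg mf) (funeneg_ge0 _)).
  by apply: eq_integral => t _; rewrite -[RHS]/(((EFin \o f)^\- \o flip c)%E t)
    -funeneg_comp.
Qed.

Lemma Rintegral_ge_itv f a b k : mu.-integrable setT (EFin \o f) ->
  (forall t, 0 <= f t) -> 0 <= k -> a <= b ->
  (forall t, a <= t <= b -> k <= f t) -> k * (b - a) <= \int[mu]_t f t.
Proof.
move=> intf f0 k0 ab kf.
have -> : k * (b - a) = \int[mu]_(t in `[a, b]) k.
  rewrite Rintegral_cst//= lebesgue_measure_itv/= lte_fin.
  by move: ab; rewrite le_eqVlt => /orP[/eqP->|->//]; rewrite ltxx subrr.
rewrite Rintegral_mkcond; apply: le_Rintegral => //.
  rewrite (_ : _ \o _ = (EFin \o (fun=> k)) \_ `[a, b]); last first.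
    by apply/funext => t; rewrite /= !patchE; case: ifP.
  have H : mu.-integrable `[a, b] (EFin \o (fun=> k)).
    apply: continuous_compact_integrable; first exact: segment_compact.
    by apply: continuous_subspaceT => z; exact: cvg_cst.
  by move/integrable_mkcond : H; apply.
move=> t _; rewrite patchE; case: ifPn => // /[!inE] /= /[!in_itv] /= h.
exact: kf.
Qed.

Lemma Rintegral_gt0 f p : mu.-integrable setT (EFin \o f) ->
  (forall t, 0 <= f t) -> {for p, continuous f} -> 0 < f p ->
  0 < \int[mu]_t f t.
Proof.
move=> intf f0 cf fp.
have /cvgrPdist_lt/(_ _ (divr_gt0 fp (ltr0Sn R 1))) := cf.
move=> [e /= e0 he].
have e20 : 0 < e / 2 by rewrite divr_gt0.
apply: (@lt_le_trans _ _ (f p / 2 * ((p + e / 2) - p))).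
  by rewrite mulr_gt0// ?divr_gt0//; lra.
apply: Rintegral_ge_itv => //; [by rewrite ltW// divr_gt0|lra|].
move=> t /andP[t1 t2]; have /he : ball_ Num.norm p e t.
  by rewrite /= ler0_norm; lra.
by move=> /(le_lt_trans (ler_norm _)); lra.
Qed.

(** * The kernel and the convergence of the integrals *)

Lemma continuous_powR_gt0 p x : 0 < x -> {for x, continuous (fun t : R => t `^ p)}.
Proof.
move=> x0; apply/differentiable_continuous/derivable1_diffP.
exact: (@ex_derive _ _ _ _ _ _ _ (is_derive1_powR p x0)).
Qed.

Lemma is_derive_powR_primitive p x : 0 < x -> p + 1 != 0 ->
  is_derive x 1 (fun t : R => (p + 1)^-1 * t `^ (p + 1)) (x `^ p).
Proof.
move=> x0 p0.
have dx := is_derive1_powR (p + 1) x0.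
have -> : x `^ p = (p + 1)^-1 *: ((p + 1) * x `^ (p + 1 - 1)).
  by rewrite addrK /GRing.scale /= mulrA mulVf// mul1r.
exact: (@is_deriveZ _ _ _ (fun t : R => t `^ (p + 1)) (p + 1)^-1 x 1).
Qed.

Lemma integral_powR_itv p a b : 0 < a -> a < b -> p + 1 != 0 ->
  (\int[mu]_(x in `[a, b]) (x `^ p)%:E =
   ((p + 1)^-1 * b `^ (p + 1) - (p + 1)^-1 * a `^ (p + 1))%:E)%E.
Proof.
move=> a0 ab p0; rewrite EFinB.
have dF x : 0 < x -> is_derive x 1 (fun t : R => (p + 1)^-1 * t `^ (p + 1))
    (x `^ p) by move=> x0; exact: is_derive_powR_primitive.
have cF x : 0 < x ->
    {for x, continuous (fun t : R => (p + 1)^-1 * t `^ (p + 1))}.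
  move=> x0; apply/differentiable_continuous/derivable1_diffP.
  exact: (@ex_derive _ _ _ _ _ _ _ (dF x x0)).
apply: (@continuous_FTC2 _ (fun t => t `^ p)
  (fun t => (p + 1)^-1 * t `^ (p + 1)) a b) => //.
- apply: derivable_within_continuous => x /[!in_itv]/= /andP[ax _].
  by apply: derivable_powR; rewrite in_itv/= andbT (lt_le_trans a0).
- split.
  + move=> x /[!in_itv]/= /andP[ax _].
    exact: (@ex_derive _ _ _ _ _ _ _ (dF x (lt_trans a0 ax))).
  + exact/cvg_at_right_filter/cF.
  + exact/cvg_at_left_filter/cF/(lt_trans a0).
- move=> x /[!in_itv]/= /andP[ax _]; rewrite derive1E.
  exact: (@derive_val _ _ _ _ _ _ _ (dF x (lt_trans a0 ax))).
Qed.

(** Exhaust the interval by [[1/(n+2), 1]], where the integrals have the common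
    bound 1/(p+1). *)
Lemma integrable_powR_near0 p : -1 < p ->
  mu.-integrable `]0, 1] (EFin \o (fun t => t `^ p)).
Proof.
move=> p1; have p0 : 0 < p + 1 by lra.
have mp (D : set R) : measurable D ->
    measurable_fun D (EFin \o (fun t : R => t `^ p)).
  move=> mD; apply/measurable_EFinP; apply: measurable_funTS.
  exact: measurable_powR.
apply/integrableP; split; first exact: mp.
under eq_integral do rewrite /= ger0_norm ?powR_ge0//.
pose F n : set R := `[(n.+2%:R)^-1, 1]%classic.
have F01 : `]0, 1]%classic = \bigcup_n F n.
  apply/seteqP; split => [t|t [n _]] /=; rewrite /F /= !in_itv/=; last first.
    by move=> /andP[h ->]; rewrite andbT (lt_le_trans _ h)// invr_gt0.
  move=> /andP[t0 t1]; exists (Num.truncn t^-1) => //=; rewrite in_itv/= t1 andbT.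
  by rewrite invf_ple ?posrE// ltW// (lt_trans (truncnS_gt _))// ltr_nat.
have cv : (\int[mu]_(x in F i) (x `^ p)%:E)%E @[i --> \oo] -->
    (\int[mu]_(x in \bigcup_i F i) (x `^ p)%:E)%E.
  apply: ge0_nondecreasing_set_cvg_integral.
  - move=> n m nm; apply/subsetPset => t; rewrite /F /= !in_itv/= => /andP[h ->].
    by rewrite andbT (le_trans _ h)// lef_pV2 ?posrE// ler_nat !ltnS.
  - by move=> n; exact: measurable_itv.
  - by move=> n; apply: mp; exact: measurable_itv.
  - by move=> n t _; rewrite /= lee_fin powR_ge0.
rewrite F01; apply: (@le_lt_trans _ _ ((p + 1)^-1)%:E); last exact: ltry.
rewrite -(cvg_lim _ cv)//; apply: lime_le; first exact: (cvgP _ cv).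
apply: nearW => n; rewrite integral_powR_itv ?gt_eqF//; last first.
  by rewrite invf_lt1 ?ltr1n.
by rewrite lee_fin powR1 mulr1 gerBl// mulr_ge0// ?powR_ge0// invr_ge0 ltW.
Qed.

Lemma integrable_powR_neary p : p < -1 ->
  mu.-integrable `[1, +oo[ (EFin \o (fun t => t `^ p)).
Proof.
move=> p1; have p0 : p + 1 < 0 by lra.
have dF x : 0 < x -> is_derive x 1 (fun t : R => (p + 1)^-1 * t `^ (p + 1))
    (x `^ p) by move=> x0; apply: is_derive_powR_primitive => //; rewrite lt_eqF.
apply/integrableP; split.
  apply/measurable_EFinP; apply: measurable_funTS; exact: measurable_powR.
under eq_integral do rewrite /= ger0_norm ?powR_ge0//.
rewrite (@ge0_continuous_FTC2y _ _ (fun t : R => (p + 1)^-1 * t `^ (p + 1)) _ 0).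
- by rewrite -EFinB ltry.
- by move=> x _; exact: powR_ge0.
- apply: derivable_within_continuous => x /[!in_itv]/= /andP[ax _].
  by apply: derivable_powR; rewrite in_itv/= andbT (lt_le_trans ltr01).
- rewrite -[X in _ --> X](mulr0 (p + 1)^-1); apply: cvgMr.
  apply/cvgr0Pnorm_lt => e e0.
  exists (e `^ (p + 1)^-1); split=> [|t te]; first exact: num_real.
  have t0 : 0 < t by exact: le_lt_trans (powR_ge0 _ _) te.
  rewrite ger0_norm ?powR_ge0// -[p + 1]opprK powRN invf_plt ?posrE ?powR_gt0//.
  suff -> : e^-1 = (e `^ (p + 1)^-1) `^ - (p + 1).
    by apply: gt0_ltr_powR; rewrite ?nnegrE ?powR_ge0 ?oppr_gt0 ?(ltW t0).
  by rewrite -powRrM mulrN mulVf ?lt_eqF// powR_inv1// ltW.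
- move=> x x1; exact: (@ex_derive _ _ _ _ _ _ _ (dF x (lt_trans ltr01 x1))).
- have c1 : {for 1, continuous (fun t : R => (p + 1)^-1 * t `^ (p + 1))}.
    apply/differentiable_continuous/derivable1_diffP.
    exact: (@ex_derive _ _ _ _ _ _ _ (dF 1 ltr01)).
  exact/cvg_at_right_filter/c1.
- move=> x /[!in_itv]/= /andP[x1 _]; rewrite derive1E.
  exact: (@derive_val _ _ _ _ _ _ _ (dF x (lt_trans ltr01 x1))).
Qed.

Definition kernel s (t : R) : R := `|t| `^ (- (1 + 2 * s)).

Lemma divr_kernel s x t : x / (`|t| `^ (1 + 2 * s)) = x * kernel s t.
Proof. by rewrite /kernel powRN. Qed.

Lemma kernel_ge0 s t : 0 <= kernel s t. Proof. exact: powR_ge0. Qed.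

Lemma kernel_gt0 s t : t != 0 -> 0 < kernel s t.
Proof. by move=> t0; rewrite powR_gt0// normr_gt0. Qed.

Lemma kernelN s t : kernel s (- t) = kernel s t.
Proof. by rewrite /kernel normrN. Qed.

Lemma kernel_nincr s t t' : 0 < s -> t != 0 -> `|t| <= `|t'| ->
  kernel s t' <= kernel s t.
Proof.
move=> s0 t0 tt'; rewrite /kernel !powRN lef_pV2 ?posrE ?powR_gt0 ?normr_gt0//.
  by apply: ge0_ler_powR; rewrite ?nnegrE//; lra.
by rewrite -normr_gt0 (lt_le_trans _ tt')// normr_gt0.
Qed.

Lemma kernel_decr s t t' : 0 < s -> t != 0 -> `|t| < `|t'| ->
  kernel s t' < kernel s t.
Proof.
move=> s0 t0 tt'; rewrite /kernel !powRN ltf_pV2 ?posrE ?powR_gt0 ?normr_gt0//.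
  by apply: gt0_ltr_powR; rewrite ?nnegrE//; lra.
by rewrite -normr_gt0 (lt_trans _ tt')// normr_gt0.
Qed.

Lemma continuous_kernel s t : t != 0 -> {for t, continuous (kernel s)}.
Proof.
move=> t0; apply: (@continuous_comp _ _ _ (fun y : R => `|y|) (fun y => y `^ _)).
  exact: norm_continuous.
by apply: continuous_powR_gt0; rewrite normr_gt0.
Qed.

Lemma measurable_kernel s : measurable_fun setT (kernel s).
Proof.
apply: (@measurableT_comp _ _ _ _ _ _ (fun y : R => y `^ (- (1 + 2 * s)))).
  exact: measurable_powR.
exact: normr_measurable.
Qed.

Lemma le_integrable_EFin (f g : R -> R) :
  measurable_fun setT f -> (forall t, `|f t| <= g t) ->
  mu.-integrable setT (EFin \o g) -> mu.-integrable setT (EFin \o f).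
Proof.
move=> mf fg; apply: le_integrable => //; first exact/measurable_EFinP.
move=> t _ /=; rewrite lee_fin (le_trans (fg t))//; exact: ler_norm.
Qed.

(** On the positive half line the function is dominated by t^(1-2s) near 0 and by
    t^(-1-2s) at infinity; the conditions 0 < s < 1 are exactly the integrability
    of these two powers. The negative half line is its reflection. *)
Lemma integrable_truncated_kernel s : 0 < s -> s < 1 ->
  mu.-integrable setT (EFin \o (fun t => Num.min 1 (t ^+ 2) * kernel s t)).
Proof.
move=> s0 s1.
pose p1 : R -> R := (fun t : R => t `^ (1 - 2 * s)) \_ `]0, 1].
pose p2 : R -> R := (fun t : R => t `^ (- 1 - 2 * s)) \_ `[1, +oo[.
have i1 : mu.-integrable setT (EFin \o p1).
  have /integrable_mkcond : mu.-integrable `]0, 1]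
    (EFin \o (fun t : R => t `^ (1 - 2 * s))).
    by apply: integrable_powR_near0; lra.
  by rewrite -restrict_EFin; apply.
have i2 : mu.-integrable setT (EFin \o p2).
  have /integrable_mkcond : mu.-integrable `[1, +oo[
    (EFin \o (fun t : R => t `^ (- 1 - 2 * s))).
    by apply: integrable_powR_neary; lra.
  by rewrite -restrict_EFin; apply.
have ip : mu.-integrable setT (EFin \o (fun t => p1 t + p2 t)).
  exact: (integrableD _ i1 i2).
have := integrableD measurableT ip (integrable_flip 0 ip).
apply: le_integrable_EFin.
  apply: measurable_funM; last exact: measurable_kernel.
  apply: measurable_minr; first exact: measurable_cst.
  exact: exprn_measurable.
have p10 t : 0 <= p1 t by rewrite /p1 patchE; case: ifP => // _; exact: powR_ge0.
have p20 t : 0 <= p2 t by rewrite /p2 patchE; case: ifP => // _; exact: powR_ge0.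
have key t : 0 < t -> Num.min 1 (t ^+ 2) * kernel s t <= p1 t + p2 t.
  move=> t0; rewrite /kernel gtr0_norm//.
  have [t1|t1] := lerP t 1.
    apply: (@le_trans _ _ (p1 t)); last by rewrite lerDl.
    rewrite /p1 patchE mem_set /=; last by rewrite in_itv/= t0.
    rewrite [leRHS](_ : _ = t ^+ 2 * t `^ (- (1 + 2 * s))).
      by rewrite ler_wpM2r ?powR_ge0// ge_min lexx orbT.
    rewrite -powR_mulrn ?ltW// -powRD; first by congr powR; lra.
    by rewrite (gt_eqF t0) implybT.
  apply: (@le_trans _ _ (p2 t)); last by rewrite lerDr.
  rewrite /p2 patchE mem_set /=; last by rewrite in_itv/= ltW.
  rewrite (_ : - (1 + 2 * s) = - 1 - 2 * s); last lra.
  by rewrite ler_piMl ?powR_ge0// ge_min lexx.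
move=> t; rewrite ger0_norm; last first.
  by rewrite mulr_ge0 ?kernel_ge0// le_min ler01 sqr_ge0.
rewrite /flip /= sub0r.
have [t0|t0|->] := ltgtP t 0.
- rewrite -[leLHS]/(Num.min 1 (t ^+ 2) * kernel s t) -kernelN -sqrrN.
  by apply: le_trans (key _ _) _; rewrite ?oppr_gt0// lerDr addr_ge0.
- by apply: le_trans (key _ t0) _; rewrite lerDl addr_ge0.
- by rewrite expr0n/= min_r// mul0r !addr_ge0.
Qed.

(** Such a [g] is at most a multiple of min(1, t^2): for |t| >= r the bound [M] is
    at most (M / r^2) t^2. *)
Lemma integrable_kernel s g r M : 0 < s -> s < 1 -> 0 < r ->
  measurable_fun setT g -> (forall t, `|g t| <= M) ->
  (forall t, `|t| < r -> `|g t| <= M * t ^+ 2) ->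
  mu.-integrable setT (EFin \o (fun t => g t * kernel s t)).
Proof.
move=> s0 s1 r0 mg gM gr.
have M0 : 0 <= M by exact: le_trans (gM 0).
pose C := M + M / r ^+ 2.
have r20 : 0 < r ^+ 2 by rewrite exprn_gt0.
have := integrableZl measurableT C (integrable_truncated_kernel s0 s1).
apply: le_integrable_EFin; first exact: (measurable_funM mg (measurable_kernel s)).
move=> t; rewrite normrM (ger0_norm (kernel_ge0 _ _)) /= mulrA.
rewrite ler_wpM2r ?kernel_ge0// /C mulrDl.
have D0 : 0 <= M / r ^+ 2 by rewrite divr_ge0// ltW.
have m0 : 0 <= Num.min 1 (t ^+ 2) by rewrite le_min ler01 sqr_ge0.
have [t1|t1] := lerP 1 (t ^+ 2).
  by rewrite mulr1 (le_trans (gM t))// lerDl mulr1.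
have [tr|tr] := ltrP `|t| r.
  by rewrite (le_trans (gr _ tr))// lerDl mulr_ge0// sqr_ge0.
rewrite (le_trans (gM t))// (@le_trans _ _ (M / r ^+ 2 * t ^+ 2))//.
  rewrite mulrAC -mulrA ler_peMr// ler_pdivlMr// mul1r.
  by rewrite -(real_normK (num_real t)) lerXn2r ?nnegrE// ltW.
by rewrite lerDr mulr_ge0// sqr_ge0.
Qed.

Definition second_difference (phi : R -> R) t : R :=
  phi t + phi (- t) - 2 * phi 0.

Lemma second_differenceN (phi : R -> R) t :
  second_difference phi (- t) = second_difference phi t.
Proof. by rewrite /second_difference opprK (addrC (phi _)). Qed.

(** Two applications of the mean value theorem to phi, one on either side of 0,
    and one to its derivative between the two intermediate points. *)
Lemma second_difference_le (phi phi1 phi2 : R -> R) r M t :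
  (forall t, `|t| < r -> is_derive t 1 phi (phi1 t)) ->
  (forall t, `|t| < r -> is_derive t 1 phi1 (phi2 t)) ->
  (forall t, `|t| < r -> `|phi2 t| <= M) ->
  `|t| < r -> `|second_difference phi t| <= 2 * M * t ^+ 2.
Proof.
move=> d1 d2 b2; wlog t0 : t / 0 <= t => [H tr|].
  have [t0|/ltW t0] := lerP 0 t; first exact: H.
  by rewrite -second_differenceN -sqrrN H ?normrN// oppr_ge0.
rewrite ger0_norm// => tr.
have mvt (f df : R -> R) a b : - t <= a -> a <= b -> b <= t ->
    (forall t, `|t| < r -> is_derive t 1 f (df t)) ->
    exists2 c, a <= c <= b & f b - f a = df c * (b - a).
  move=> ta ab bt fd.
  have fd' x : a <= x <= b -> is_derive x 1 f (df x).
    by move=> /andP[ax xb]; apply: fd; rewrite ltr_norml; apply/andP; split; lra.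
  have [||c] := @MVT_segment R f df a b ab; last by rewrite in_itv/=; exists c.
    by move=> x /[!in_itv]/= /andP[ax xb]; apply: fd'; rewrite !ltW.
  apply: derivable_within_continuous => x /[!in_itv]/= xab.
  exact: (@ex_derive _ _ _ _ _ _ _ (fd' x xab)).
have [c1 /andP[c10 c1t] e1] : exists2 c, 0 <= c <= t &
  phi t - phi 0 = phi1 c * (t - 0) by apply: mvt => //; lra.
have [c2 /andP[c2t c20] e2] : exists2 c, - t <= c <= 0 &
  phi 0 - phi (- t) = phi1 c * (0 - - t) by apply: mvt => //; lra.
have [c3 /andP[c32 c31] e3] : exists2 c, c2 <= c <= c1 &
  phi1 c1 - phi1 c2 = phi2 c * (c1 - c2) by apply: mvt => //; lra.
have -> : second_difference phi t = phi2 c3 * ((c1 - c2) * t).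
  rewrite mulrA -e3 /second_difference.
  have -> : phi t = phi 0 + phi1 c1 * (t - 0) by rewrite -e1; ring.
  have -> : phi (- t) = phi 0 - phi1 c2 * (0 - - t) by rewrite -e2; ring.
  by ring.
rewrite normrM -mulrA mulrCA ler_pM//.
  by apply: b2; rewrite ltr_norml; apply/andP; split; lra.
rewrite ger0_norm ?mulr_ge0//; last lra.
by rewrite expr2 mulrA ler_wpM2r//; lra.
Qed.

Lemma integrable_second_difference s (phi phi1 phi2 : R -> R) B r M :
  0 < s -> s < 1 -> continuous phi -> (forall t, `|phi t| <= B) -> 0 < r ->
  (forall t, `|t| < r -> is_derive t 1 phi (phi1 t)) ->
  (forall t, `|t| < r -> is_derive t 1 phi1 (phi2 t)) ->
  (forall t, `|t| < r -> `|phi2 t| <= M) ->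
  mu.-integrable setT (EFin \o (fun t => second_difference phi t * kernel s t)).
Proof.
move=> s0 s1 cphi phiB r0 d1 d2 b2.
have B0 : 0 <= B by exact: le_trans (phiB 0).
have M0 : 0 <= M by apply: le_trans (b2 0 _); rewrite ?normr0.
apply: (integrable_kernel (M := 4 * B + 2 * M) s0 s1 r0).
- apply: continuous_measurable_fun => t; apply: cvgB; last exact: cvg_cst.
  apply: cvgD; first exact: cphi.
  by apply: continuous_comp; [exact: opp_continuous|exact: cphi].
- move=> t; have := phiB t; have := phiB (- t); have := phiB 0.
  rewrite /second_difference !ler_norml => /andP[? ?] /andP[? ?] /andP[? ?].
  by apply/andP; split; lra.
- move=> t tr; apply: le_trans (second_difference_le d1 d2 b2 tr) _.
  by rewrite ler_wpM2r ?sqr_ge0//; lra.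
Qed.

(** The integrand is -1/2 times the second difference of the cosine at 0 times
    the kernel, so that the integral converges; it is nonnegative and positive at
    [pi]. Without convergence the inverse could be 0. *)
Lemma Cs_gt0 s : 0 < s -> s < 1 -> 0 < Cs s.
Proof.
move=> s0 s1; rewrite /Cs invr_gt0.
under eq_Rintegral do rewrite divr_kernel.
have cos_le t : `|cos t| <= 1 by rewrite ler_norml cos_geN1 cos_le1.
have int_cos := @integrable_second_difference s cos (fun t => - sin t)
  (fun t => - cos t) 1 1 1 s0 s1 (@continuous_cos R) cos_le ltr01.
apply: (Rintegral_gt0 (p := pi)).
- have -> : EFin \o (fun t => (1 - cos t) * kernel s t) = (fun t =>
      (- 2^-1)%:E * (second_difference cos t * kernel s t)%:E)%E.
    apply/funext => t; rewrite /= -EFinM /second_difference cosN cos0.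
    by congr EFin; field.
  by apply: integrableZl => //; apply: int_cos => t _; rewrite normrN.
- by move=> t; rewrite mulr_ge0 ?kernel_ge0// subr_ge0 cos_le1.
- apply: cvgM; last by apply: continuous_kernel; rewrite gt_eqF// pi_gt0.
  by apply: cvgB; [exact: cvg_cst|exact: continuous_cos].
- by rewrite mulr_gt0 ?kernel_gt0 ?gt_eqF ?pi_gt0// cospi opprK.
Qed.

(** * Functions that are odd about a point and minimal on one side of it *)

(** [phi] is the restriction of a deficit to a line orthogonal to the hyperplane:
    odd about [- d], where the line crosses the hyperplane, and minimal at 0 among
    the points [t >= - d]. *)
Section antisymmetric.
Variables (s d m B : R) (phi : R -> R).
Hypotheses (s0 : 0 < s) (s1 : s < 1) (d0 : 0 < d) (m0 : 0 <= m).
Hypotheses (cphi : continuous phi) (phiB : forall t, `|phi t| <= B).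
Hypothesis anti : forall t, phi (flip (- (2 * d)) t) = - phi t.
Hypothesis phi0 : phi 0 = - m.
Hypothesis phi_ge : forall t, - d <= t -> - m <= phi t.
Hypothesis intG :
  mu.-integrable setT (EFin \o (fun t => second_difference phi t * kernel s t)).

Let F t : R := (phi t + m) * kernel s t.
Let folded t : R := F t + F (flip (- (2 * d)) t).

Let second_difference_flip t :
  second_difference phi t * kernel s t = F t + F (flip 0 t).
Proof. by rewrite /F /flip sub0r kernelN /second_difference phi0; ring. Qed.

Let phiDm_ge0 t : - d <= t -> 0 <= phi t + m.
Proof. by move=> /phi_ge; lra. Qed.

Let B0 : 0 <= B. Proof. exact: le_trans (phiB 0). Qed.

(** Without symmetrization the integral of a function against the singular kernel
    need not converge. It does here because 0 is a minimum: for |t| < d both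
    terms of the symmetrized integrand are nonnegative, so that each is dominated
    by their sum, and away from 0 the kernel is integrable. *)
Let intF : mu.-integrable setT (EFin \o F).
Proof.
pose C := (B + m) / Num.min 1 (d ^+ 2).
have := integrableD measurableT (integrable_norm intG)
  (integrableZl measurableT C (integrable_truncated_kernel s0 s1)).
apply: le_integrable_EFin.
  apply: measurable_funM; last exact: measurable_kernel.
  by apply: continuous_measurable_fun => t; apply: cvgD; [exact: cphi|exact: cvg_cst].
have min0 : 0 < Num.min 1 (d ^+ 2) by rewrite lt_min ltr01 exprn_gt0.
have C0 : 0 <= C by rewrite /C divr_ge0 ?addr_ge0// ltW.
move=> t /=; rewrite second_difference_flip.
have [td|td] := ltrP `|t| d.
  move: (td); rewrite ltr_norml => /andP[t1 t2].
  have F0 x : - d <= x -> 0 <= F x by move=> /phiDm_ge0 ?; rewrite mulr_ge0 ?kernel_ge0.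
  have F1 : 0 <= F t by apply: F0; lra.
  have F2 : 0 <= F (flip 0 t) by apply: F0; rewrite /flip; lra.
  rewrite !ger0_norm ?addr_ge0// -addrA lerDl addr_ge0//.
  rewrite (mulr_ge0 C0)// mulr_ge0 ?kernel_ge0//.
  by rewrite le_min ler01 sqr_ge0.
rewrite -[leLHS]add0r lerD// normrM (ger0_norm (kernel_ge0 _ _)) mulrA.
rewrite ler_wpM2r ?kernel_ge0//.
rewrite (@le_trans _ _ (B + m))//.
  by rewrite (le_trans (ler_normD _ _))// (ger0_norm m0) lerD2r.
rewrite /C mulrAC -mulrA ler_peMr ?addr_ge0// ler_pdivlMr// mul1r.
rewrite le_min !ge_min lexx /= -(real_normK (num_real t)).
by rewrite [X in _ || X]lerXn2r ?orbT// nnegrE// ltW.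
Qed.

Let integrable_folded : mu.-integrable setT (EFin \o folded).
Proof. exact: (integrableD _ intF (integrable_flip _ intF)). Qed.

(** The left side is the integral of [F] symmetrized about 0, the right side that
    of [F] symmetrized about [- d]; reflections preserve integrals, so both are
    twice the integral of [F]. *)
Let integral_folded :
  \int[mu]_t (second_difference phi t * kernel s t) = \int[mu]_t folded t.
Proof.
under eq_Rintegral do rewrite second_difference_flip.
rewrite (RintegralD measurableT intF (integrable_flip 0 intF)).
rewrite (RintegralD measurableT intF (integrable_flip (- (2 * d)) intF)).
by rewrite !(Rintegral_flip _ intF).
Qed.

(** By oddness the term at the mirror image of t is (2m - (phi t + m)) K(t + 2d),
    and the kernel K decreases from |t| to t + 2d. *)
Let folded_ge t : - d <= t -> 2 * m * kernel s (t + 2 * d) <= folded t.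
Proof.
move=> td; rewrite /folded /F anti.
have td2 : 0 <= t + 2 * d by have := d0; lra.
have -> : kernel s (flip (- (2 * d)) t) = kernel s (t + 2 * d).
  by rewrite -kernelN /flip; congr kernel; ring.
have [->|t0] := eqVneq t 0; first by rewrite phi0 add0r; lra.
have : 0 <= (phi t + m) * (kernel s t - kernel s (t + 2 * d)).
  rewrite mulr_ge0 ?phiDm_ge0// subr_ge0 kernel_nincr//.
  rewrite [leRHS]ger0_norm //.
  have d_gt0 := d0; rewrite ler_norml; apply/andP; split; lra.
by lra.
Qed.

Let folded_ge0 t : 0 <= folded t.
Proof.
have pos x : - d <= x -> 0 <= folded x.
  by move=> /folded_ge; apply: le_trans; rewrite !mulr_ge0 ?kernel_ge0.
have [/pos//|td] := lerP (- d) t.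
have <- : folded (flip (- (2 * d)) t) = folded t by rewrite /folded flipK addrC.
by apply: pos; rewrite /flip; have := d0; lra.
Qed.

(** The lower bound of the folded integrand is kept on [[- d, 0]] only, an interval
    of length d on which K(t + 2d) >= K(2d); the result is of order m d^(-2s). *)
Lemma antisymmetric_integral_ge :
  2 * m * kernel s (2 * d) * d <=
    \int[mu]_t (second_difference phi t * kernel s t).
Proof.
have d_gt0 := d0; rewrite integral_folded.
rewrite -[X in _ * X](_ : 0 - - d = d); last by rewrite sub0r opprK.
apply: Rintegral_ge_itv => //.
- by rewrite !mulr_ge0 ?kernel_ge0.
- by lra.
move=> t /andP[td t0]; apply: le_trans (folded_ge td).
rewrite ler_wpM2l ?mulr_ge0// kernel_nincr//; first lra.
by rewrite !ger0_norm; lra.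
Qed.

(** For m = 0 the folded integrand at p is phi(p) (K(p) - K(p + 2d)) > 0, because p
    is strictly closer to 0 than its mirror image is. *)
Lemma antisymmetric_integral_gt0 p : m = 0 -> - d < p -> p != 0 -> 0 < phi p ->
  0 < \int[mu]_t (second_difference phi t * kernel s t).
Proof.
move=> mE pd pn0 phip; rewrite integral_folded.
have d_gt0 := d0.
have fE : flip (- (2 * d)) p != 0 by rewrite /flip lt_eqF//; lra.
have cF x : x != 0 -> {for x, continuous F}.
  move=> x0; apply: cvgM; last exact: continuous_kernel.
  by apply: cvgD; [exact: cphi|exact: cvg_cst].
apply: (Rintegral_gt0 (p := p)) => //.
  apply: cvgD; first exact: cF.
  by apply: continuous_comp; [exact: continuous_flip|exact: cF].
rewrite /folded /F anti mE !addr0 mulNr -mulrBr mulr_gt0// subr_gt0.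
have fl : `|flip (- (2 * d)) p| = p + 2 * d.
  by rewrite -normrN /flip ger0_norm; lra.
by rewrite kernel_decr// fl ltr_norml; apply/andP; split; lra.
Qed.

End antisymmetric.

End line_integrals.

(** * Reflections in hyperplanes orthogonal to the axes *)

Section hyperplane_reflection.
Context {R : realType} {N : nat}.
Implicit Types (x y z : 'rV[R]_N) (i j : 'I_N) (lam t : R).
Local Notation e i := (basis_vec R i).

Lemma coordD_basis x i j t :
  (x + t *: e i) 0 j = x 0 j + (if j == i then t else 0).
Proof.
by rewrite !mxE eqxx /= eq_sym; case: eqP => _ /=; rewrite ?mulr1 ?mulr0.
Qed.

Definition sqnorm x : R := \sum_(j < N) x 0 j ^+ 2.

Lemma unit_ballE x : @unit_ball R N x <-> sqnorm x < 1.
Proof.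
rewrite /unit_ball /enorm /= -/(sqnorm x) -[X in _ < X]sqrtr1.
by rewrite ltr_sqrt.
Qed.

Lemma sqr_coord_le x i : x 0 i ^+ 2 <= sqnorm x.
Proof.
by rewrite /sqnorm (bigD1 i)//= lerDl; apply: sumr_ge0 => j _; exact: sqr_ge0.
Qed.

Lemma sqnormD_basis x i t :
  sqnorm (x + t *: e i) = sqnorm x + 2 * t * x 0 i + t ^+ 2.
Proof.
rewrite /sqnorm (bigD1 i)//= [in RHS](bigD1 i)//= coordD_basis eqxx.
rewrite (eq_bigr (fun j => x 0 j ^+ 2)); last first.
  by move=> j /negPf ji; rewrite coordD_basis ji addr0.
by ring.
Qed.

(** The reflection in the hyperplane {x_i = lam}. The affine form makes joint
    continuity in [lam] and [x] immediate. *)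
Definition mirror i lam x := x + (2 * (lam - x 0 i)) *: e i.

Lemma mirror_coord i lam x : mirror i lam x 0 i = 2 * lam - x 0 i.
Proof. by rewrite coordD_basis eqxx; ring. Qed.

Lemma mirror0 i x : mirror i 0 x = reflection i x.
Proof.
apply/rowP => j; rewrite coordD_basis mxE sub0r.
by case: eqP => [->|_]; ring.
Qed.

Lemma mirror_fix i lam x : x 0 i = lam -> mirror i lam x = x.
Proof. by rewrite /mirror => ->; rewrite subrr mulr0 scale0r addr0. Qed.

Lemma mirrorK i lam : involutive (mirror i lam).
Proof.
move=> x; rewrite [LHS]/mirror mirror_coord /mirror -addrA -scalerDl.
by rewrite [X in X *: _](_ : _ = 0) ?scale0r ?addr0//; ring.
Qed.

Lemma mirrorD_basis i lam x j t :
  mirror i lam (x + t *: e j) =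
  mirror i lam x + (if j == i then - t else t) *: e j.
Proof.
rewrite /mirror coordD_basis eq_sym.
have [->|_] := eqVneq j i; last by rewrite addr0 addrAC.
rewrite -!addrA; congr (_ + _); rewrite -!scalerDl; congr (_ *: _); ring.
Qed.

(** For lam > 0 the reflection brings the points with x_i > lam closer to the
    origin: this is why the mirror image of a cap of the ball stays in the ball. *)
Lemma sqnorm_mirror i lam x :
  sqnorm (mirror i lam x) = sqnorm x - 4 * lam * (x 0 i - lam).
Proof. by rewrite sqnormD_basis; ring. Qed.

Lemma continuous_coord i : continuous (fun x => x 0 i).
Proof. exact: coord_continuous. Qed.

Lemma continuous_sqnorm : continuous sqnorm.
Proof.
apply: continuous_big => [|j _]; first exact: add_continuous.
move=> x; apply: (@continuous_comp _ _ _
  (fun x : 'rV[R]_N => x 0 j) (fun y : R => y ^+ 2)).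
  exact: coord_continuous.
exact: exprn_continuous.
Qed.

Lemma continuous_line x i : continuous (fun t => x + t *: e i).
Proof. by move=> t; apply: cvgD; [exact: cvg_cst|apply: cvgZr_tmp; exact: cvg_id]. Qed.

Lemma continuous_mirror_pair i :
  continuous (fun p : R * 'rV[R]_N => mirror i p.1 p.2).
Proof.
move=> [l x]; apply: cvgD; first exact: cvg_snd.
apply: cvgZr_tmp; apply: cvgM; first exact: cvg_cst.
apply: cvgB; first exact: cvg_fst.
by apply: (@cvg_comp _ _ _ snd (fun x => x 0 i)); [exact: cvg_snd|exact: coord_continuous].
Qed.

Lemma continuous_mirror i lam : continuous (mirror i lam).
Proof.
move=> x; apply: (@continuous_comp _ _ _ (fun x => (lam, x))
  (fun p : R * 'rV[R]_N => mirror i p.1 p.2)); last exact: continuous_mirror_pair.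
move=> A [[P Q] /= [/nbhs_singleton lP xQ] PQA].
by apply: filterS xQ => y Qy; exact: (PQA (lam, y)).
Qed.

Lemma open_unit_ball : open (@unit_ball R N).
Proof.
rewrite (_ : @unit_ball R N = sqnorm @^-1` [set t | t < 1]); last first.
  by apply/seteqP; split => x; rewrite unit_ballE.
by apply: open_comp; [move=> x _; exact: continuous_sqnorm|exact: open_lt].
Qed.

Lemma compact_closed_ball : compact [set x | sqnorm x <= 1].
Proof.
apply: bounded_closed_compact.
  exists 1; split; first exact: num_real.
  move=> M M1 x /= x1; rewrite [leLHS]/Num.norm /= mx_normrE.
  apply: bigmax_le => [|[k j] _ /=]; first by rewrite (le_trans ler01)// ltW.
  rewrite (ord1 k) (le_trans _ (ltW M1))// -(@ler_pXn2r _ 2)// ?nnegrE//.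
  by rewrite real_normK ?num_real// expr1n (le_trans (sqr_coord_le _ _)).
apply: (@closed_comp _ _ sqnorm [set t | t <= 1]); last exact: closed_le.
by move=> x _; exact: continuous_sqnorm.
Qed.

Definition cap i lam : set 'rV[R]_N := [set x | sqnorm x <= 1 /\ lam <= x 0 i].

Lemma compact_cap i lam : compact (cap i lam).
Proof.
apply: (subclosed_compact _ compact_closed_ball); last by move=> x [].
apply: closedI.
  apply: (@closed_comp _ _ sqnorm [set t | t <= 1]); last exact: closed_le.
  by move=> x _; exact: continuous_sqnorm.
apply: (@closed_comp _ _ (fun x => x 0 i) [set t | lam <= t]).
  by move=> x _; exact: continuous_coord.
exact: closed_ge.
Qed.

End hyperplane_reflection.

(** * The operator along lines and under reflections *)

Section directional_operators.
Context {R : realType} {N : nat}.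
Implicit Types (u v w : 'rV[R]_N -> R) (x y z : 'rV[R]_N) (i j : 'I_N).
Implicit Types (s lam t : R).
Local Notation mu := (@lebesgue_measure R).
Local Notation e i := (basis_vec R i).

Definition slice u x j t : R := u (x + t *: e j).

Lemma slice0 u x j : slice u x j 0 = u x.
Proof. by rewrite /slice scale0r addr0. Qed.

Lemma continuous_slice u x j : continuous u -> continuous (slice u x j).
Proof.
move=> cu t; apply: (@continuous_comp _ _ _ (fun t => x + t *: e j) u).
  exact: continuous_line.
exact: cu.
Qed.

Definition I_integrand s j u x t : R :=
  second_difference (slice u x j) t * kernel s t.

Definition I_integrable s j u x :=
  mu.-integrable setT (EFin \o I_integrand s j u x).

Lemma I_dirE s j u x :
  I_dir s j u x = Cs s / 2 * \int[mu]_t I_integrand s j u x t.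
Proof.
rewrite /I_dir; congr (_ * _); apply: eq_Rintegral => t _.
by rewrite divr_kernel /I_integrand /second_difference slice0 /slice scaleNr.
Qed.

Lemma slice_mirror u i lam x j t :
  slice (u \o mirror i lam) x j t =
  slice u (mirror i lam x) j (if j == i then - t else t).
Proof. by rewrite /slice /= mirrorD_basis. Qed.

(** Reflecting reverses the line in the direction [e_i], but second differences
    are even. *)
Lemma I_integrand_mirror s j u i lam x t :
  I_integrand s j (u \o mirror i lam) x t = I_integrand s j u (mirror i lam x) t.
Proof.
rewrite /I_integrand; congr (_ * _).
rewrite /second_difference !slice_mirror.
by case: eqP => // _; rewrite oppr0 opprK (addrC (slice _ _ _ _)).
Qed.

Lemma I_integrable_mirror s j u i lam x :
  I_integrable s j u (mirror i lam x) -> I_integrable s j (u \o mirror i lam) x.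
Proof.
apply: eq_integrable => // t _.
by rewrite /= I_integrand_mirror.
Qed.

Lemma I_op_mirror s u i lam x :
  I_op s (u \o mirror i lam) x = I_op s u (mirror i lam x).
Proof.
apply: eq_bigr => j _; rewrite !I_dirE; congr (_ * _).
by apply: eq_Rintegral => t _; rewrite I_integrand_mirror.
Qed.

Lemma I_integrandB s j u v x t :
  I_integrand s j (fun y => u y - v y) x t =
  I_integrand s j u x t - I_integrand s j v x t.
Proof. by rewrite /I_integrand /second_difference /slice; ring. Qed.

Lemma I_integrableB s j u v x : I_integrable s j u x -> I_integrable s j v x ->
  I_integrable s j (fun y => u y - v y) x.
Proof.
move=> iu iv; have := integrableB measurableT iu iv.
by apply: eq_integrable => // t _; rewrite /= I_integrandB.
Qed.

Lemma I_opB s u v x : (forall j, I_integrable s j u x) ->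
  (forall j, I_integrable s j v x) ->
  I_op s (fun y => u y - v y) x = I_op s u x - I_op s v x.
Proof.
move=> iu iv; rewrite /I_op -sumrB; apply: eq_bigr => j _.
rewrite !I_dirE -mulrBr -(RintegralB measurableT (iu j) (iv j)).
by congr (_ * _); apply: eq_Rintegral => t _; rewrite I_integrandB.
Qed.

(** The slice of [u] through [x] is twice differentiable near 0, and its second
    derivative, being continuous at 0, is bounded there. *)
Lemma C2_I_integrable s j u x (B : R) : 0 < s -> s < 1 ->
  C2_on (@unit_ball R N) u -> continuous u -> (forall y, `|u y| <= B) ->
  unit_ball x -> I_integrable s j u x.
Proof.
move=> s0 s1 [C1u C2u] cu uB Bx.
pose u1 y := 'D_(e j) u y; pose u2 y := 'D_(e j) u1 y.
pose M := `|u2 x| + 1.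
have lineD (v : 'rV[R]_N -> R) t : derivable v (x + t *: e j) (e j) ->
    is_derive t 1 (slice v x j) ('D_(e j) v (x + t *: e j)).
  move=> dv.
  have quot : (fun h => h^-1 *: ((slice v x j \o shift t) (h *: (1 : R)) - slice v x j t)) =
      (fun h => h^-1 *: ((v \o shift (x + t *: e j)) (h *: e j) - v (x + t *: e j))).
    apply/funext => h; rewrite /slice /= addrCA -scalerDl.
    by rewrite [h *: 1]mulr1.
  split.
    by rewrite /derivable quot.
  by rewrite /derive quot.
have [r r0 hr] : exists2 r, 0 < r & forall t, `|t| < r ->
    unit_ball (x + t *: e j) /\ `|u2 (x + t *: e j)| <= M.
  have cx : {for 0, continuous (fun t => x + t *: e j)} by exact: continuous_line.
  have nx : \forall y \near x, unit_ball y /\ `|u2 y| <= M.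
    near=> y; split.
      by near: y; apply: open_nbhs_nbhs; split; [exact: open_unit_ball|].
    have : `|u2 x - u2 y| < 1.
      near: y; have /cvgrPdist_lt := (C2u j j).2 x Bx; exact.
    rewrite distrC /M => h; rewrite -[u2 y](subrK (u2 x)).
    by rewrite (le_trans (ler_normD _ _))// addrC lerD2l ltW.
  have := cx _; rewrite scale0r addr0 => /(_ _ nx)[r /= r0 hr].
  by exists r => // t tr; apply: hr; rewrite /= sub0r normrN.
have d1 t : `|t| < r -> is_derive t 1 (slice u x j) (slice u1 x j t).
  by move=> /hr[Bt _]; apply: lineD; exact: (C1u j).1.
have d2 t : `|t| < r -> is_derive t 1 (slice u1 x j) (slice u2 x j t).
  by move=> /hr[Bt _]; apply: lineD; exact: (C2u j j).1.
have b2 t : `|t| < r -> `|slice u2 x j t| <= M by move=> /hr[].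
have uxB t : `|slice u x j t| <= B by exact: uB.
have cx : continuous (slice u x j) by exact: continuous_slice.
exact: (integrable_second_difference s0 s1 cx uxB r0 d1 d2 b2).
Unshelve. all: by end_near. Qed.

End directional_operators.

(** * Moving planes *)

Section moving_planes.
Context {R : realType} {N : nat}.
Implicit Types (u : 'rV[R]_N -> R) (x y z : 'rV[R]_N) (i j : 'I_N).
Implicit Types (s lam t : R) (f : R -> R).
Local Notation e i := (basis_vec R i).

Lemma continuous_bounded u : continuous u ->
  (forall x, ~ unit_ball x -> u x = 0) -> exists B : R, forall x, `|u x| <= B.
Proof.
move=> cu u0.
have /compact_bounded[B [_ HB]] : compact (u @` [set x | sqnorm x <= 1]).
  apply: continuous_compact; first exact: continuous_subspaceT.
  exact: compact_closed_ball.
exists (Num.max B 0 + 1) => x.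
have B1 : B < Num.max B 0 + 1 by rewrite ltr_pwDr// le_max lexx.
have [x1|x1] := lerP (sqnorm x) 1; first by apply: (HB _ B1); exists x.
rewrite u0 ?normr0 ?addr_ge0 ?le_max ?lexx ?orbT//.
by rewrite unit_ballE => /lt_trans - /(_ _ x1); rewrite ltxx.
Qed.

(** What the moving planes use of a classical solution: C^2 regularity only enters
    through the convergence of the integrals, and in this form the hypotheses are
    clearly invariant under reflections. *)
Record regular_solution s f u : Prop := {
  sol_continuous : continuous u ;
  sol_integrable : forall x, unit_ball x -> forall j, I_integrable s j u x ;
  sol_eq : forall x, unit_ball x -> - I_op s u x = f (u x) ;
  sol_gt0 : forall x, unit_ball x -> 0 < u x ;
  sol_eq0 : forall x, ~ unit_ball x -> u x = 0 }.

Lemma sol_ge0 s f u x : regular_solution s f u -> 0 <= u x.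
Proof.
move=> sol; have [Bx|nBx] := pselect (unit_ball x).
  exact/ltW/(sol_gt0 sol).
by rewrite (sol_eq0 sol).
Qed.

Lemma regular_solution_mirror s f u i : regular_solution s f u ->
  regular_solution s f (u \o mirror i 0).
Proof.
move=> sol; have ballE x : unit_ball (mirror i 0 x) <-> unit_ball x.
  by rewrite !unit_ballE sqnorm_mirror mulr0 mul0r subr0.
split.
- move=> x; apply: (@continuous_comp _ _ _ (mirror i 0) u).
    exact: continuous_mirror.
  exact: (sol_continuous sol).
- move=> x Bx j; apply: I_integrable_mirror.
  by apply: (sol_integrable sol); exact/ballE.
- by move=> x Bx; rewrite I_op_mirror; apply: (sol_eq sol); exact/ballE.
- by move=> x Bx; apply: (sol_gt0 sol); exact/ballE.
- by move=> x Bx; apply: (sol_eq0 sol) => /ballE.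
Qed.

Definition deficit u i lam x : R := u (mirror i lam x) - u x.

Lemma deficitN u i lam x : deficit u i lam (mirror i lam x) = - deficit u i lam x.
Proof. by rewrite /deficit mirrorK opprB. Qed.

Lemma continuous_deficit_pair u i : continuous u ->
  continuous (fun p : R * 'rV[R]_N => deficit u i p.1 p.2).
Proof.
move=> cu p; apply: (@cvgB _ _ _ _ _ (fun p => u (mirror i p.1 p.2))
  (fun p => u p.2)).
  apply: (@continuous_comp _ _ _ (fun p : R * 'rV[R]_N => mirror i p.1 p.2) u).
    exact: continuous_mirror_pair.
  exact: cu.
by apply: (@continuous_comp _ _ _ snd u); [exact: cvg_snd|exact: cu].
Qed.

Lemma continuous_deficit u i lam : continuous u -> continuous (deficit u i lam).
Proof.
move=> cu.
have cm : continuous (u \o mirror i lam).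
  move=> x; apply: (@continuous_comp _ _ _ (mirror i lam) u).
    exact: continuous_mirror.
  exact: cu.
by move=> x; apply: continuousB; [exact: cm|exact: cu].
Qed.

Section comparison.
Variables (s : R) (f : R -> R) (u : 'rV[R]_N -> R) (i : 'I_N).
Hypotheses (s0 : 0 < s) (s1 : s < 1) (sol : regular_solution s f u).

Lemma mirror_ball lam x : 0 <= lam -> lam <= x 0 i -> unit_ball x ->
  unit_ball (mirror i lam x).
Proof.
move=> l0 lx; rewrite !unit_ballE sqnorm_mirror; apply: le_lt_trans.
by rewrite gerBl mulr_ge0// ?mulr_ge0// subr_ge0.
Qed.

Lemma deficit_integrable lam x j : 0 <= lam -> lam <= x 0 i -> unit_ball x ->
  I_integrable s j (deficit u i lam) x.
Proof.
move=> l0 lx Bx; apply: (@I_integrableB _ _ _ _ (u \o mirror i lam)).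
  by apply/I_integrable_mirror/(sol_integrable sol)/mirror_ball.
exact: (sol_integrable sol).
Qed.

Lemma I_op_deficit lam x : 0 <= lam -> lam <= x 0 i -> unit_ball x ->
  I_op s (deficit u i lam) x = f (u x) - f (u (mirror i lam x)).
Proof.
move=> l0 lx Bx; have Bm := mirror_ball l0 lx Bx.
rewrite -[deficit u i lam]/(fun y => (u \o mirror i lam) y - u y) I_opB.
- by rewrite I_op_mirror -!(sol_eq sol)// opprK addrC.
- by move=> j; apply/I_integrable_mirror/(sol_integrable sol).
- exact: (sol_integrable sol).
Qed.

(** A line through [x] in a direction tangential to the hyperplane stays in the
    half space over which [x] is a minimum, so its contribution to the operator
    is nonnegative and can be dropped. *)
Lemma I_dir_le_I_op lam x : 0 <= lam -> lam < x 0 i -> unit_ball x ->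
  (forall y, lam <= y 0 i -> deficit u i lam x <= deficit u i lam y) ->
  I_dir s i (deficit u i lam) x <= f (u x) - f (u (mirror i lam x)).
Proof.
move=> l0 lx Bx minx; rewrite -(I_op_deficit l0 (ltW lx) Bx).
rewrite /I_op (bigD1 i)//= lerDl.
apply: sumr_ge0 => j ji; rewrite I_dirE.
have C0 : 0 <= Cs s / 2 by rewrite divr_ge0// ltW// Cs_gt0.
rewrite (mulr_ge0 C0)//; apply: Rintegral_ge0 => t _.
rewrite /I_integrand mulr_ge0 ?kernel_ge0//.
have le_slice t' : deficit u i lam x <= slice (deficit u i lam) x j t'.
  by apply: minx; rewrite coordD_basis eq_sym (negPf ji) addr0 ltW.
rewrite /second_difference slice0.
have := le_slice t; have := le_slice (- t); lra.
Qed.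

Section at_minimum.
Variables (lam : R) (x : 'rV[R]_N).
Hypotheses (l0 : 0 <= lam) (lx : lam < x 0 i) (Bx : unit_ball x).
Hypothesis neg : deficit u i lam x <= 0.
Hypothesis minx : forall y, lam <= y 0 i -> deficit u i lam x <= deficit u i lam y.

Let d := x 0 i - lam.
Let phi := slice (deficit u i lam) x i.

Let d_gt0 : 0 < d. Proof. by rewrite subr_gt0. Qed.

Let phi_anti t : phi (flip (- (2 * d)) t) = - phi t.
Proof.
rewrite /phi /slice -deficitN mirrorD_basis eqxx /mirror -addrA -scalerDl.
by congr (deficit _ _ _ (_ + _ *: _)); rewrite /flip /d; ring.
Qed.

Let phi_min t : - d <= t -> - - deficit u i lam x <= phi t.
Proof.
rewrite opprK => td; apply: minx; rewrite coordD_basis eqxx.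
by move: td; rewrite /d; lra.
Qed.

Let phi_bounded : exists B : R, forall t, `|phi t| <= B.
Proof.
have [B uB] := continuous_bounded (sol_continuous sol) (sol_eq0 sol).
exists (B + B) => t; rewrite (le_trans (ler_normB _ _))// lerD//.
Qed.

Let phi_cont : continuous phi.
Proof. exact/continuous_slice/continuous_deficit/(sol_continuous sol). Qed.

Let phi0 : phi 0 = - - deficit u i lam x.
Proof. by rewrite /phi slice0 opprK. Qed.

Lemma minimum_bound :
  Cs s * (- deficit u i lam x) * (kernel s (2 * d) * d) <=
    f (u x) - f (u (mirror i lam x)).
Proof.
apply: le_trans (I_dir_le_I_op l0 lx Bx minx).
have [B phiB] := phi_bounded.
have m0 : 0 <= - deficit u i lam x by rewrite oppr_ge0.
have := antisymmetric_integral_ge s0 s1 d_gt0 m0 phi_cont phiB phi_anti phi0 phi_min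
  (deficit_integrable i l0 (ltW lx) Bx).
rewrite I_dirE => H.
have C0 : 0 <= Cs s / 2 by rewrite divr_ge0// ltW// Cs_gt0.
apply: le_trans (ler_wpM2l C0 H).
by rewrite le_eqVlt; apply/orP; left; apply/eqP; field.
Qed.

Lemma zero_minimum_not_positive t : deficit u i lam x = 0 -> 0 < t ->
  0 < deficit u i lam (x + t *: e i) -> False.
Proof.
move=> w0 t0 wt.
have [B phiB] := phi_bounded.
have m0 : 0 <= - deficit u i lam x by rewrite oppr_ge0.
have mE : - deficit u i lam x = 0 by rewrite w0 oppr0.
have td : - d < t by rewrite (lt_trans _ t0)// oppr_lt0.
have := antisymmetric_integral_gt0 s0 s1 d_gt0 m0 phi_cont phiB phi_anti phi0 phi_min
  (deficit_integrable i l0 (ltW lx) Bx) mE td (negbT (gt_eqF t0)) wt.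
have := I_dir_le_I_op l0 lx Bx minx.
move: w0; rewrite {1}/deficit => /eqP; rewrite subr_eq0 => /eqP ->.
rewrite subrr I_dirE pmulr_rle0 ?divr_gt0 ?Cs_gt0//.
by move=> /le_lt_trans h /h; rewrite ltxx.
Qed.

End at_minimum.

(** A zero inside the ball would be a minimum with value 0. The line through it in
    the direction [e_i] then has a point with positive deficit, namely the point
    where it leaves the ball. *)
Lemma deficit_gt0 lam : 0 < lam -> lam < 1 ->
  (forall y, lam <= y 0 i -> 0 <= deficit u i lam y) ->
  forall y, sqnorm y <= 1 -> lam < y 0 i -> 0 < deficit u i lam y.
Proof.
move=> l0 l1 w0.
have sphere y : sqnorm y = 1 -> lam < y 0 i -> 0 < deficit u i lam y.
  move=> y1 ly; rewrite /deficit (sol_eq0 sol (x := y)) ?subr0; last first.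
    by rewrite unit_ballE y1 ltxx.
  apply: (sol_gt0 sol); rewrite unit_ballE sqnorm_mirror y1 gtrBl.
  by rewrite mulr_gt0 ?mulr_gt0// subr_gt0.
move=> y; rewrite le_eqVlt => /orP[/eqP|y1] ly; first exact: sphere.
rewrite lt_neqAle (w0 _ (ltW ly)) andbT; apply/negP => /eqP wy.
have yi : 0 < y 0 i by exact: lt_trans ly.
have disc : 0 < y 0 i ^+ 2 + (1 - sqnorm y).
  by rewrite addr_gt0 ?exprn_gt0// subr_gt0.
(* y + t e_i is the point of the line beyond y that lies on the unit sphere *)
pose t := Num.sqrt (y 0 i ^+ 2 + (1 - sqnorm y)) - y 0 i.
have t0 : 0 < t.
  rewrite subr_gt0 -[X in X < _](ger0_norm (ltW yi)) -sqrtr_sqr ltr_sqrt//.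
  by rewrite ltrDl subr_gt0.
apply: (@zero_minimum_not_positive lam y _ _ _ _ _ t _ t0).
- exact: ltW.
- exact: ly.
- exact/unit_ballE.
- by rewrite -wy.
- by move=> z lz; rewrite -wy w0.
- by rewrite -wy.
apply: sphere; last by rewrite coordD_basis eqxx ltr_wpDr// ltW.
have tE : (t + y 0 i) ^+ 2 = y 0 i ^+ 2 + (1 - sqnorm y).
  by rewrite subrK sqr_sqrtr// ltW.
rewrite sqnormD_basis; move: tE; rewrite !expr2; lra.
Qed.

(** The deficit is nonnegative on the hyperplane and outside the ball, so that a
    minimum over the compact cap is an interior point of it and a minimum over
    the whole half space. *)
Lemma deficit_negative_minimum lam y : 0 <= lam -> lam < y 0 i ->
  deficit u i lam y < 0 ->
  exists x, [/\ unit_ball x, lam < x 0 i, deficit u i lam x < 0 &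
    forall z, lam <= z 0 i -> deficit u i lam x <= deficit u i lam z].
Proof.
move=> l0 ly wy.
have out z : lam <= z 0 i -> 1 <= sqnorm z -> 0 <= deficit u i lam z.
  move=> lz z1; rewrite /deficit (sol_eq0 sol (x := z)) ?subr0 ?(sol_ge0 _ sol)//.
  by rewrite unit_ballE; apply/negP; rewrite -leNgt.
have capy : cap i lam y.
  split; last exact: ltW.
  by rewrite leNgt; apply/negP => /ltW/(out _ (ltW ly)); rewrite leNgt wy.
have [x /[!inE] [[x1 lx] minx]] := EVT_min_rV (ex_intro _ y capy)
  (@compact_cap R N i lam)
  (continuous_subspaceT (continuous_deficit (i := i) (lam := lam) (sol_continuous sol))).
have wx : deficit u i lam x < 0.
  by apply: le_lt_trans wy; apply: minx; rewrite inE.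
exists x; split => //.
- by rewrite unit_ballE ltNge; apply/negP => /(out _ lx); rewrite leNgt wx.
- rewrite lt_neqAle lx andbT; apply/eqP => xl.
  by move: wx; rewrite /deficit mirror_fix// subrr ltxx.
- move=> z lz; have [z1|z1] := lerP (sqnorm z) 1.
    by apply: minx; rewrite inE.
  by rewrite (le_trans (ltW wx))// out// ltW.
Qed.

Hypothesis lip : lipschitz f.

(** At a minimum [x] with value -m < 0 at distance d from the hyperplane,
    [minimum_bound] and the Lipschitz condition give c m d^(-2s) <= L m, which
    fails for small d. *)
Lemma narrow_region : exists2 d0 : R, 0 < d0 & forall lam y, 0 <= lam ->
  lam < y 0 i -> deficit u i lam y < 0 ->
  exists x, [/\ unit_ball x, lam + d0 <= x 0 i & deficit u i lam x < 0].
Proof.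
have [L L0 hL] : exists2 L, 0 < L & forall a b, `|f a - f b| <= L * `|a - b|.
  have [M [_ hM]] := lip.
  exists (Num.max M 0 + 1).
    by rewrite ltr_wpDl// le_max lexx orbT.
  have M1 : M < Num.max M 0 + 1 by rewrite ltr_pwDr// le_max lexx.
  by move=> a b; have := hM _ M1 (a, b); apply.
have C0 : 0 < Cs s by exact: Cs_gt0.
have e0 : 0 < Cs s / (2 * L) by rewrite divr_gt0// mulr_gt0.
have [r /= r0 hr] : \forall a \near (0 : R)^'+, a `^ (2 * s) < Cs s / (2 * L).
  have s20 : 0 < 2 * s by rewrite mulr_gt0.
  have /cvgrPdist_lt/(_ _ e0) := powR_cvg0 s20.
  apply: filterS => a; rewrite sub0r normrN; apply: le_lt_trans.
  exact: ler_norm.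
exists (r / 2); first by rewrite divr_gt0.
move=> lam y l0 ly wy.
have [x [Bx lx wx minx]] := deficit_negative_minimum l0 ly wy.
exists x; split => //; rewrite leNgt; apply/negP => close.
pose d := x 0 i - lam; have d0 : 0 < d by rewrite subr_gt0.
have /(hr (2 * d)) : ball_ Num.norm 0 r (2 * d).
  by rewrite /= sub0r normrN gtr0_norm ?mulr_gt0// mulrC -ltr_pdivlMr// ltrBlDl.
rewrite mulr_gt0// => /(_ isT) small.
have := minimum_bound l0 lx Bx (ltW wx) minx; rewrite -/d; apply/negP; rewrite -ltNge.
apply: (@le_lt_trans _ _ (L * (- deficit u i lam x))).
  rewrite (le_trans (ler_norm _))// (le_trans (hL _ _))//.
  by rewrite distrC -/(deficit u i lam x) ltr0_norm.
rewrite mulrAC ltr_pM2r ?oppr_gt0//.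
have P0 : 0 < (2 * d) `^ (2 * s) by rewrite powR_gt0// mulr_gt0.
have -> : kernel s (2 * d) * d = (2 * (2 * d) `^ (2 * s))^-1.
  have d20 : 0 < 2 * d by rewrite mulr_gt0.
  rewrite /kernel powRN gtr0_norm//.
  rewrite powRD; last by rewrite (gt_eqF d20) implybT.
  rewrite powRr1 ?(ltW d20)//.
  by field; rewrite !gt_eqF.
rewrite ltr_pdivlMr ?mulr_gt0// mulrCA mulrA mulrC -ltr_pdivlMr//.
by rewrite mulr_gt0.
Qed.

(** By [deficit_gt0] the deficit is positive on the compact cap, which includes a
    part of the sphere; joint continuity carries this over to nearby planes. *)
Lemma deficit_gt0_open lam : 0 < lam -> lam < 1 ->
  (forall y, lam <= y 0 i -> 0 <= deficit u i lam y) ->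
  forall c, lam < c -> \forall l \near lam, forall y, cap i c y -> 0 < deficit u i l y.
Proof.
move=> l0 l1 w0 c lc.
have /compact_near_coveringP := @compact_cap R N i c.
move=> /(_ R (nbhs lam) (fun l y => 0 < deficit u i l y) _); apply => y [y1 cy].
have wy : 0 < deficit u i lam y.
  by apply: deficit_gt0 => //; exact: lt_le_trans cy.
have cw : {for (lam, y), continuous (fun p : R * 'rV[R]_N => deficit u i p.1 p.2)}.
  exact: continuous_deficit_pair (sol_continuous sol) _.
have := cw _ (open_nbhs_nbhs (conj (@open_gt R 0) wy)).
move=> [[A B] /= [lA yB] AB].
by exists (B, A) => //= -[z l] /= [Bz Al]; exact: (AB (l, z)).
Qed.

Lemma deficit_ge0_closed lam : lam < 1 ->
  (forall l, lam < l -> l < 1 -> forall y, l <= y 0 i -> 0 <= deficit u i l y) ->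
  forall y, lam <= y 0 i -> 0 <= deficit u i lam y.
Proof.
move=> l1 good y; rewrite le_eqVlt => /orP[/eqP ly|ly].
  by rewrite /deficit mirror_fix// subrr.
rewrite leNgt; apply/negP => wy.
have cw : {for (lam, y), continuous (fun p : R * 'rV[R]_N => deficit u i p.1 p.2)}.
  exact: continuous_deficit_pair (sol_continuous sol) _.
have := cw _ (open_nbhs_nbhs (conj (@open_lt R 0) wy)).
move=> [[A B] /= [[r /= r0 lA] /nbhs_singleton By] AB].
pose q := Num.min (lam + r / 2) (Num.min ((lam + 1) / 2) ((lam + y 0 i) / 2)).
have lq : lam < q by rewrite !lt_min; apply/and3P; split; lra.
have qr : q <= lam + r / 2 by rewrite ge_min lexx.
have q1 : q < 1.
  by rewrite !gt_min; apply/orP; right; apply/orP; left; lra.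
have qy : q <= y 0 i.
  by rewrite !ge_min; apply/orP; right; apply/orP; right; lra.
have /lA Aq : ball_ Num.norm lam r q.
  by rewrite /= ltr0_norm; lra.
by have := AB (q, y) (conj Aq By); rewrite /= ltNge good.
Qed.

(** The planes are moved down from lam = 1 by a supremum argument. The width d0 of
    [narrow_region] is used twice: it keeps the supremum of the bad positions below
    1, and it places the negative values for a bad position l near L in the cap
    over the height L + d0/2. *)
Lemma deficit_ge0 lam : 0 < lam -> lam < 1 ->
  forall y, lam <= y 0 i -> 0 <= deficit u i lam y.
Proof.
have [d0 d00 narrow] := narrow_region.
pose bad : set R := [set l : R | [/\ 0 < l, l < 1 &
  exists2 y : 'rV[R]_N, l < y 0 i & deficit u i l y < 0]].
have good l : 0 < l -> l < 1 -> ~ bad l ->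
    forall y, l <= y 0 i -> 0 <= deficit u i l y.
  move=> l0 l1 nbad y; rewrite le_eqVlt => /orP[/eqP ly|ly].
    by rewrite /deficit mirror_fix// subrr.
  by rewrite leNgt; apply/negP => wy; apply: nbad; split => //; exists y.
move=> l0 l1; apply: (good _ l0 l1) => badl.
have far l : bad l -> exists x,
    [/\ unit_ball x, l + d0 <= x 0 i & deficit u i l x < 0].
  by move=> [h0 _ [y ly wy]]; exact: (narrow l y (ltW h0)).
have bad_le l : bad l -> l <= 1 - d0.
  move=> /far[x [/unit_ballE x1 lx _]].
  have xi : x 0 i < 1.
    have [x0|x0] := ltP (x 0 i) 0; first exact: lt_trans ltr01.
    rewrite -(@ltr_pXn2r _ 2)// ?nnegrE// expr1n.
    exact: le_lt_trans (sqr_coord_le x i) x1.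
  by lra.
have sbad : has_sup bad by split; [exists lam|exists (1 - d0) => l /bad_le].
pose L := sup bad.
have L0 : 0 < L by rewrite (lt_le_trans l0)//; apply: ub_le_sup => //; case: sbad.
have L1 : L < 1.
  by rewrite (@le_lt_trans _ _ (1 - d0)) ?gtrBl//; apply: ge_sup => //; case: sbad.
have wL : forall y, L <= y 0 i -> 0 <= deficit u i L y.
  apply: deficit_ge0_closed => // l Ll l1'; apply: good => //.
    exact: lt_trans Ll.
  by move=> /(ub_le_sup (proj2 sbad)); rewrite leNgt Ll.
have Ld : L < L + d0 / 2 by rewrite ltrDl divr_gt0.
have [r /= r0 hr] := deficit_gt0_open L0 L1 wL Ld.
have [|l badl' lL] := @sup_adherent _ bad (Num.min r (d0 / 2)) _ sbad.
  by rewrite lt_min r0 divr_gt0.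
have lleL : l <= L by apply: ub_le_sup => //; case: sbad.
have [x [/unit_ballE Bx lx wx]] := far _ badl'.
have [lr ld] : L - r < l /\ L - d0 / 2 < l.
  by split; apply: le_lt_trans lL; rewrite lerD2l lerN2 ge_min lexx ?orbT.
have /hr/(_ x) : ball_ Num.norm L r l.
  by rewrite /= ger0_norm; lra.
rewrite ltNge (ltW wx) => /(_ _)/negP; apply => //; split; first exact: ltW.
by lra.
Qed.

Lemma mirror_lt lam y : 0 < lam -> lam < 1 -> sqnorm y <= 1 -> lam < y 0 i ->
  u y < u (mirror i lam y).
Proof.
move=> l0 l1 y1 ly; rewrite -subr_gt0 -/(deficit u i lam y).
by apply: deficit_gt0 => //; exact: deficit_ge0.
Qed.

Lemma reflection_ge x : 0 <= x 0 i -> u x <= u (mirror i 0 x).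
Proof.
move=> xi; rewrite -subr_ge0 -/(deficit u i 0 x).
by apply: deficit_ge0_closed xi => // l l0 l1; exact: deficit_ge0.
Qed.

(** The point at height t1 is the mirror image of the point at height t2 in the
    hyperplane at height (t1 + t2)/2 > 0. *)
Lemma regular_solution_decreasing : decreasing_in i u.
Proof.
move=> z t1 t2; rewrite /hyperplane /= => zi t10 t12 _ /unit_ballE B2.
have x2 : (z + t2 *: e i) 0 i = t2 by rewrite coordD_basis eqxx zi add0r.
have t21 : t2 < 1.
  have t20 : 0 <= t2 by exact: le_trans (ltW t12).
  rewrite -(@ltr_pXn2r _ 2)// ?nnegrE// expr1n -x2.
  exact: le_lt_trans (sqr_coord_le _ i) B2.
have -> : z + t1 *: e i = mirror i ((t1 + t2) / 2) (z + t2 *: e i).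
  by rewrite /mirror x2 -addrA -scalerDl; congr (_ + _ *: _); field.
apply: mirror_lt; rewrite ?x2.
- by lra.
- by lra.
- exact: ltW.
- by lra.
Qed.

End comparison.

(** The limit lam = 0 gives one inequality between [u] and its reflection, and the
    same inequality for the reflected solution is the converse. *)
Lemma regular_solution_symmetric s f u i : 0 < s -> s < 1 -> lipschitz f ->
  regular_solution s f u -> symmetric_wrt i u.
Proof.
move=> s0 s1 lip sol.
have half x : 0 <= x 0 i -> u (mirror i 0 x) = u x.
  move=> xi; apply/eqP; rewrite eq_le (reflection_ge s0 s1 sol lip xi) andbT.
  have := reflection_ge s0 s1 (regular_solution_mirror i sol) lip xi.
  by rewrite /= mirrorK.
move=> x; rewrite -mirror0; have [/half//|xi] := lerP 0 (x 0 i).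
by rewrite -[in RHS](mirrorK i 0 x) (half (mirror i 0 x))// mirror_coord; lra.
Qed.

End moving_planes.

(** The solution is continuous on the closed ball and vanishes on the closed
    complement of the open ball; these two closed sets cover the space. *)
Lemma classical_solution_regular (R : realType) (N : nat) (s : R) (f : R -> R)
    (u : 'rV[R]_N -> R) : 0 < s -> s < 1 -> C2_on (@unit_ball R N) u ->
  classical_solution s f u -> regular_solution s f u.
Proof.
move=> s0 s1 C2u [cu eqn u_gt0 u_eq0].
have {}cu : continuous u.
  have cover : closure (@unit_ball R N) `|` ~` @unit_ball R N = setT.
    apply/seteqP; split => // x _; have [Bx|nBx] := pselect (unit_ball x).
      by left; exact: subset_closure.
    by right.
  apply/continuous_subspace_setT; rewrite -cover; apply: withinU_continuous.
  - exact: closed_closure.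
  - by apply: open_closedC; exact: open_unit_ball.
  - exact: cu.
  - apply: (@subspace_eq_continuous _ _ _ (cst 0)).
      by move=> x; rewrite inE => /u_eq0.
    by apply: continuous_subspaceT; exact: cst_continuous.
have [B uB] := continuous_bounded cu u_eq0.
split => // x Bx j; exact: (C2_I_integrable _ s0 s1 C2u cu uB Bx).
Qed.

Unset Implicit Arguments.

Theorem theorem1p8 (R : realType) (N : nat) (s : R) (f : R -> R)
    (u : 'rV[R]_N -> R)
    (hN : (2 <= N)%N) (hs0 : 0 < s) (hs1 : s < 1)
    (hf : lipschitz f)
    (hC2 : C2_on (@unit_ball R N) u) (hLs : Ls_space s u)
    (hu : classical_solution s f u) :
  forall i : 'I_N, symmetric_wrt i u /\ decreasing_in i u.
Proof.
move=> i; have sol := classical_solution_regular hs0 hs1 hC2 hu.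
split; first exact: regular_solution_symmetric sol.
exact: regular_solution_decreasing sol hf.
Qed.
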